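(* Let $(x,a,p,s)\in\mathbb{C}^4$. Then $(x,a,p,s)\in\mathbb{F}$ if and only if $(s,ax-p)\in\mathbb{G}_2$, $p\in\mathbb{D}$ and \[ 1-|a|^2-|x|^2+|p|^2-\frac{|s|^2}{2}-\frac{|s^2-4(ax-p)|}{2}>0 . \]
   Context: $\mathbb{D}=\{z\in\mathbb{C}:|z|<1\}$; $M_2(\mathbb{C})$ is the space of $2\times 2$ complex matrices and $\|A\|$ is the operator norm of $A$. The domain $\mathbb{F}$ is \[ \mathbb{F}=\{(a_{11},a_{22},\det(A),a_{12}+a_{21})\in\mathbb{C}^4 : A=(a_{ij})_{i,j=1}^2\in M_2(\mathbb{C}),\ \|A\|<1\}. \] The symmetrized bidisc is $\mathbb{G}_2=\{(z_1+z_2,z_1z_2)\in\mathbb{C}^2 : |z_1|<1,\ |z_2|<1\}$. *)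

(* Defs.v *)
From mathcomp Require Import all_boot all_order all_algebra.
From mathcomp Require Import classical_sets reals.
From mathcomp Require Import complex.
Set Implicit Arguments.
Unset Strict Implicit.
Unset Printing Implicit Defensive.
Import Order.TTheory GRing.Theory Num.Theory.
Local Open Scope classical_set_scope.
Local Open Scope ring_scope.

(* For R : realType, R[i] is the field of complex numbers.  Its norm `|z| is
   the usual modulus, but as an element of R[i]; x < y in R[i] means that
   y - x is real and positive. *)

(* The Hermitian (l^2) norm, with values in R so that suprema can be taken. *)
Definition cvnorm (R : realType) (n : nat) (v : 'cV[R[i]]_n) : R :=
  Num.sqrt (\sum_(k < n) complex.Re `|v k 0| ^+ 2).

(* The library's norm on matrices is the maximum of the moduli of the
   entries, hence this definition. *)
Definition opnorm (R : realType) (m n : nat) (A : 'M[R[i]]_(m, n)) : R :=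
  sup [set cvnorm (A *m v) | v in [set v : 'cV[R[i]]_n | cvnorm v <= 1]].

Definition unit_disc (R : realType) : set R[i] := [set z | `|z| < 1].

Definition symmetrized_bidisc (R : realType) : set (R[i] * R[i]) :=
  [set (z1 + z2, z1 * z2) | z1 in @unit_disc R & z2 in @unit_disc R].

Definition domainF (R : realType) : set (R[i] * R[i] * R[i] * R[i]) :=
  [set (A 0 0, A 1 1, \det A, A 0 1 + A 1 0)
     | A in [set A : 'M[R[i]]_2 | opnorm A < 1]].

(* Main.v *)
(** Write A = [[x, b], [c, a]] with b + c = s and b c = a x - p.  The operator
norm of A is less than 1 iff I - A^* A is positive definite, that is (for a
2x2 matrix) iff det (I - A^* A) = 1 - |x|^2 - |a|^2 - |b|^2 - |c|^2 + |det A|^2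
is positive and |det A| < 1; the latter excludes that both singular values
exceed 1.  The parallelogram law |b|^2 + |c|^2 = |b + c|^2 / 2 + |b - c|^2 / 2
and (b - c)^2 = s^2 - 4 (a x - p) turn this into the stated inequality. *)
Require Import Defs.
From mathcomp Require Import all_boot all_order all_algebra.
From mathcomp Require Import classical_sets reals complex.
From mathcomp Require Import ring lra.
Import Order.TTheory GRing.Theory Num.Theory.
Local Open Scope ring_scope.

(** The squared modulus with values in [R] and polynomial in the coordinates, so that [ring], [lra]
    and [nra] apply to it. *)
Definition sqmod {R : realType} (z : R[i]) : R :=
  complex.Re z ^+ 2 + complex.Im z ^+ 2.

Set Implicit Arguments.
Unset Strict Implicit.

Section SquaredModulus.
Variable R : realType.
Implicit Types (z w : R[i]) (t : R).

Lemma sqmod_ge0 z : 0 <= sqmod z.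
Proof. by rewrite addr_ge0 // sqr_ge0. Qed.

Lemma sqr_normE z : `|z| ^+ 2 = (sqmod z)%:C%C.
Proof. by rewrite normc_def -rmorphXn /= sqr_sqrtr ?sqmod_ge0. Qed.

Lemma sqr_Re_norm z : complex.Re `|z| ^+ 2 = sqmod z.
Proof. by rewrite normc_def /= sqr_sqrtr ?sqmod_ge0. Qed.

Lemma norm_lt1 z : (`|z| < 1) = (sqmod z < 1).
Proof. by rewrite -(@expr_lt1 _ 2) // sqr_normE ltcR. Qed.

Lemma sqmodR t : sqmod t%:C%C = t ^+ 2.
Proof. by rewrite /sqmod /= expr0n addr0. Qed.

Lemma sqmodM z w : sqmod (z * w) = sqmod z * sqmod w.
Proof. by case: z w => [? ?] [? ?]; rewrite /sqmod /=; ring. Qed.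

Lemma parallelogram z w :
  `|z + w| ^+ 2 / 2 + `|(z - w) ^+ 2| / 2 = (sqmod z + sqmod w)%:C%C.
Proof.
rewrite normrX !sqr_normE -mulrDl -rmorphD /=.
have -> : sqmod (z + w) + sqmod (z - w) = (sqmod z + sqmod w) * 2.
  by case: z w => [? ?] [? ?]; rewrite /sqmod /=; ring.
by rewrite rmorphM /= rmorph_nat mulfK // pnatr_eq0.
Qed.

End SquaredModulus.

(** * Bounds for and from the operator norm of a rectangular matrix *)

Section OperatorNorm.
Variable R : realType.

Lemma cvnorm_ge0 n (v : 'cV[R[i]]_n) : 0 <= cvnorm v.
Proof. exact: sqrtr_ge0. Qed.

Lemma sqr_cvnorm n (v : 'cV[R[i]]_n) :
  cvnorm v ^+ 2 = \sum_(k < n) sqmod (v k 0).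
Proof.
rewrite sqr_sqrtr; last by apply: sumr_ge0 => k _; rewrite sqr_ge0.
by apply: eq_bigr => k _; rewrite sqr_Re_norm.
Qed.

Lemma cvnormZ n (t : R) (v : 'cV[R[i]]_n) :
  0 <= t -> cvnorm (t%:C%C *: v) = t * cvnorm v.
Proof.
move=> t0; apply/eqP; rewrite -(@eqrXn2 _ 2) ?mulr_ge0 ?cvnorm_ge0 //.
rewrite exprMn !sqr_cvnorm mulr_sumr; apply/eqP/eq_bigr => k _.
by rewrite mxE sqmodM sqmodR.
Qed.

Lemma cvnorm0 n : cvnorm (0 : 'cV[R[i]]_n) = 0.
Proof. by rewrite -(scale0r 0) cvnormZ ?mul0r. Qed.

Lemma opnorm_le m n (A : 'M[R[i]]_(m, n)) (r : R) : 0 <= r ->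
  (forall v, cvnorm (A *m v) <= r * cvnorm v) -> opnorm A <= r.
Proof.
move=> r0 Ar; apply: ge_sup.
  by exists (cvnorm (A *m 0)), 0 => //=; rewrite cvnorm0.
by move=> _ [v /= v1 <-]; rewrite (le_trans (Ar v)) // ler_piMr.
Qed.

Lemma sqmod_le_cvnorm n (v : 'cV[R[i]]_n) k : sqmod (v k 0) <= cvnorm v ^+ 2.
Proof.
by rewrite sqr_cvnorm (bigD1 k) //= lerDl sumr_ge0 // => *; exact: sqmod_ge0.
Qed.

Lemma norm_le_cvnorm n (v : 'cV[R[i]]_n) k : `|v k 0| <= (cvnorm v)%:C%C.
Proof.
rewrite -(@ler_pXn2r _ 2) ?nnegrE ?normr_ge0 ?ler0c ?cvnorm_ge0 //.
by rewrite sqr_normE -rmorphXn lecR sqmod_le_cvnorm.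
Qed.

Lemma has_sup_opnorm m n (A : 'M[R[i]]_(m, n)) :
  has_sup [set cvnorm (A *m v) | v in [set v : 'cV[R[i]]_n | cvnorm v <= 1]]%classic.
Proof.
split; first by exists (cvnorm (A *m 0)), 0 => //=; rewrite cvnorm0.
(* Coordinates of a vector in the unit ball have modulus at most 1, so the l^1 norm of row k of [A]
   bounds entry k of [A *m v]. *)
exists (Num.sqrt (\sum_k complex.Re (\sum_j `|A k j|) ^+ 2)) => _ [v /= v1 <-].
apply: ler_wsqrtr; apply: ler_sum => k _.
have Ank : `|(A *m v) k 0| <= \sum_j `|A k j|.
  rewrite mxE (le_trans (ler_norm_sum _ _ _)) // ler_sum // => j _.
  rewrite normrM ler_piMr // (le_trans (norm_le_cvnorm _ _)) //.
  by rewrite (lecR _ 1).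
move: Ank; rewrite lecE => /andP[_ ReA].
have Re0 : 0 <= complex.Re `|(A *m v) k 0| by rewrite normc_def sqrtr_ge0.
by rewrite ler_pXn2r ?nnegrE // (le_trans Re0).
Qed.

(** By homogeneity a vector of nonzero norm can be rescaled into the unit ball; norm zero forces
    [v = 0]. *)
Lemma cvnorm_mulmx_le m n (A : 'M[R[i]]_(m, n)) v :
  cvnorm (A *m v) <= opnorm A * cvnorm v.
Proof.
have [v0|v0] := eqVneq (cvnorm v) 0.
  suff -> : v = 0 by rewrite mulmx0 !cvnorm0 mulr0.
  apply/colP => k; rewrite mxE; apply/eqP; rewrite -normr_le0.
  by have := norm_le_cvnorm v k; rewrite v0.
have vp : 0 < cvnorm v by rewrite lt_def v0 cvnorm_ge0.
have vi : 0 <= (cvnorm v)^-1 by rewrite invr_ge0 ltW.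
rewrite -ler_pdivrMr // mulrC -cvnormZ // scalemxAr.
apply: sup_upper_bound; first exact: has_sup_opnorm.
by exists ((cvnorm v)^-1%:C%C *: v) => //=; rewrite cvnormZ // mulVf.
Qed.

Lemma cvnorm_delta n (i : 'I_n) : cvnorm (delta_mx i 0 : 'cV[R[i]]_n) = 1.
Proof.
apply/eqP; rewrite -(@eqrXn2 _ 2) ?cvnorm_ge0 // sqr_cvnorm (bigD1 i) //=.
rewrite big1 => [|k ki]; first by rewrite mxE !eqxx sqmodR addr0.
by rewrite mxE (negPf ki) sqmodR expr0n.
Qed.

Lemma contraction_sqr_lt m n (A : 'M[R[i]]_(m, n)) v :
  opnorm A < 1 -> 0 < cvnorm v -> cvnorm (A *m v) ^+ 2 < cvnorm v ^+ 2.
Proof.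
move=> A1 v0; rewrite ltr_sqr ?nnegrE ?cvnorm_ge0 //.
by rewrite (le_lt_trans (cvnorm_mulmx_le A v)) // gtr_pMl.
Qed.

Lemma contraction_col_lt1 m n (A : 'M[R[i]]_(m, n)) j :
  opnorm A < 1 -> cvnorm (col j A) ^+ 2 < 1.
Proof.
move=> A1; rewrite colE -[ltRHS](expr1n _ 2) -(cvnorm_delta j).
by rewrite contraction_sqr_lt // cvnorm_delta.
Qed.

Lemma contraction_entry_lt1 m n (A : 'M[R[i]]_(m, n)) i j :
  opnorm A < 1 -> sqmod (A i j) < 1.
Proof.
move=> /(contraction_col_lt1 j); apply: le_lt_trans.
by have := sqmod_le_cvnorm (col j A) i; rewrite mxE.
Qed.

End OperatorNorm.

(** * Definiteness of t I - A^* A for 2x2 matrices *)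

Section TwoByTwo.
Variable R : realType.
Implicit Types (A : 'M[R[i]]_2) (v : 'cV[R[i]]_2) (t : R).

(** This is the trace of A^* A. The off-diagonal terms are bracketed apart because the parallelogram
    law will produce exactly them. *)
Definition sqr_frobenius A : R :=
  sqmod (A 0 0) + sqmod (A 1 1) + (sqmod (A 0 1) + sqmod (A 1 0)).

Lemma sum_ord2 (V : nmodType) (F : 'I_2 -> V) : \sum_i F i = F 0 + F 1.
Proof. by rewrite big_ord_recl big_ord1; congr (_ + F _); exact: val_inj. Qed.

Lemma sqr_cvnorm2 v : cvnorm v ^+ 2 = sqmod (v 0 0) + sqmod (v 1 0).
Proof. by rewrite sqr_cvnorm sum_ord2. Qed.

Lemma mulmx2 A v i : (A *m v) i 0 = A i 0 * v 0 0 + A i 1 * v 1 0.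
Proof. by rewrite mxE sum_ord2. Qed.

Lemma det2 A : \det A = A 0 0 * A 1 1 - A 0 1 * A 1 0.
Proof.
rewrite (expand_det_row _ 0) sum_ord2 /cofactor !det_mx11 !mxE /=.
have -> : lift 0 0 = 1 :> 'I_2 by exact: val_inj.
have -> : lift 1 0 = 0 :> 'I_2 by exact: val_inj.
by rewrite expr0 expr1 mul1r mulN1r mulrN.
Qed.

(* t I - A^* A has diagonal gram_diag t A and upper right entry - gram_off A. *)
Definition gram_diag t A (j : 'I_2) : R :=
  t - sqmod (A 0 j) - sqmod (A 1 j).

Definition gram_off A : R[i] := (A 0 0)^*%C * A 0 1 + (A 1 0)^*%C * A 1 1.

(** Two forms of the characteristic polynomial of A^* A at t: as det (t I - A^* A), and through the
    trace and the determinant of A^* A. *)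
Lemma gram_det t A :
  gram_diag t A 0 * gram_diag t A 1 - sqmod (gram_off A) =
  t ^+ 2 - t * sqr_frobenius A + sqmod (\det A).
Proof.
rewrite det2 /gram_diag /gram_off /sqr_frobenius.
case: (A 0 0) (A 0 1) (A 1 0) (A 1 1) => [? ?] [? ?] [? ?] [? ?].
by rewrite /sqmod /=; ring.
Qed.

(* Completing the square in the Hermitian form of t I - A^* A. *)
Lemma gram_form t A v :
  gram_diag t A 0 * (t * cvnorm v ^+ 2 - cvnorm (A *m v) ^+ 2) =
  sqmod ((gram_diag t A 0)%:C%C * v 0 0 - gram_off A * v 1 0) +
  (t ^+ 2 - t * sqr_frobenius A + sqmod (\det A)) * sqmod (v 1 0).
Proof.
rewrite -gram_det !sqr_cvnorm2 !mulmx2 /gram_diag /gram_off.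
case: (A 0 0) (A 0 1) (A 1 0) (A 1 1) (v 0 0) (v 1 0)
  => [? ?] [? ?] [? ?] [? ?] [? ?] [? ?].
by rewrite /sqmod /=; ring.
Qed.

Lemma opnorm_lt1P A :
  opnorm A < 1 <->
  sqmod (\det A) < 1 /\ 0 < 1 - sqr_frobenius A + sqmod (\det A).
Proof.
have gE := gram_det 1 A; rewrite expr1n mul1r in gE.
have be0 := sqmod_ge0 (gram_off A).
split=> [A1|[d1 D0]].
  have diag_gt0 j : 0 < gram_diag 1 A j.
    have := contraction_col_lt1 j A1.
    by rewrite sqr_cvnorm2 !mxE /gram_diag; lra.
  have := diag_gt0 0; have := diag_gt0 1.
  set al := gram_diag 1 A 0 in gE *; set ga := gram_diag 1 A 1 in gE *.
  move=> ga0 al0.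
  have [al1 ga1] : al <= 1 /\ ga <= 1.
    have := (sqmod_ge0 (A 0 0), sqmod_ge0 (A 0 1)).
    have := (sqmod_ge0 (A 1 0), sqmod_ge0 (A 1 1)).
    by rewrite /al /ga /gram_diag => -[? ?] [? ?]; lra.
  have frE : sqr_frobenius A = 2 - al - ga.
    by rewrite /sqr_frobenius /al /ga /gram_diag; ring.
  (* By [gE] and [frE], |det A|^2 = (1 - al) (1 - ga) - |gram_off A|^2, where [al] and [ga] lie in
     (0, 1]. *)
  split; first by nra.
  (* This vector annihilates the square in [gram_form], leaving only the determinant term. *)
  pose v : 'cV[R[i]]_2 := \col_i if i == 0 then gram_off A else al%:C%C.
  have v1 : sqmod (v 1 0) = al ^+ 2 by rewrite mxE /= sqmodR.
  have vN0 : 0 < cvnorm v.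
    rewrite lt_def cvnorm_ge0 andbT -sqrf_eq0 gt_eqF //.
    by rewrite (lt_le_trans _ (sqmod_le_cvnorm v 1)) // v1 exprn_gt0.
  have := contraction_sqr_lt A1 vN0; rewrite -subr_gt0.
  rewrite -(pmulr_rgt0 _ al0) -{1}[cvnorm v ^+ 2]mul1r gram_form v1 !mxE /=.
  rewrite -/al [_ * gram_off A]mulrC subrr (sqmodR 0) expr0n add0r expr1n mul1r.
  by rewrite pmulr_lgt0 ?exprn_gt0.
(* Strict contraction of each vector would not keep the supremum below 1. A uniform e > 0 is sought
   with (1 - e) I - A^* A positive semidefinite. *)
have det0 := sqmod_ge0 (\det A).
have frE : sqr_frobenius A = 2 - gram_diag 1 A 0 - gram_diag 1 A 1.
  by rewrite /sqr_frobenius /gram_diag; ring.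
have tr0 : 0 < 2 - sqr_frobenius A by lra.
(* The two diagonal entries have positive product, by [gE], and positive sum [tr0]. *)
have al0 : 0 < gram_diag 1 A 0 by nra.
(* det / trace of I - A^* A is a lower bound for its least eigenvalue. *)
pose e := (1 - sqr_frobenius A + sqmod (\det A)) / (2 - sqr_frobenius A).
have e0 : 0 < e by rewrite divr_gt0.
(* The trace times the first diagonal entry exceeds the product of both diagonal entries, hence the
   determinant. *)
have eal : e < gram_diag 1 A 0 by rewrite ltr_pdivrMr // -gE frE; nra.
have diagt0 : 0 < gram_diag (1 - e) A 0.
  by move: eal; rewrite /gram_diag; lra.
(* With D and T the determinant and trace of I - A^* A, the left side is D - e T + e^2, and e = D /
   T. *)
have dett : (1 - e) ^+ 2 - (1 - e) * sqr_frobenius A + sqmod (\det A) = e ^+ 2.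
  have : e * (2 - sqr_frobenius A) = 1 - sqr_frobenius A + sqmod (\det A).
    by rewrite divfK ?gt_eqF.
  by move=> eE; nra.
have t0 : 0 <= 1 - e.
  have := (sqmod_ge0 (A 0 0), sqmod_ge0 (A 1 0)).
  by move: eal; rewrite /gram_diag => ? [? ?]; lra.
suff : opnorm A <= Num.sqrt (1 - e).
  by move/le_lt_trans; apply; rewrite -[ltRHS]sqrtr1 ltr_sqrt //; lra.
apply: opnorm_le => [|v]; first exact: sqrtr_ge0.
rewrite -(@ler_pXn2r _ 2) ?nnegrE ?mulr_ge0 ?sqrtr_ge0 ?cvnorm_ge0 //.
rewrite exprMn (sqr_sqrtr t0) -subr_ge0 -(pmulr_rge0 _ diagt0).
rewrite gram_form dett; apply: addr_ge0; first exact: sqmod_ge0.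
by apply: mulr_ge0; rewrite ?sqmod_ge0 ?sqr_ge0.
Qed.

End TwoByTwo.

Theorem proposition2p2 (R : realType) (x a p s : R[i]) :
  domainF (x, a, p, s) <->
  [/\ symmetrized_bidisc (s, a * x - p),
      unit_disc p
    & 0 < 1 - `|a| ^+ 2 - `|x| ^+ 2 + `|p| ^+ 2
          - `|s| ^+ 2 / 2 - `|s ^+ 2 - 4 * (a * x - p)| / 2].
Proof.
have offdiag b c : 1 - `|a| ^+ 2 - `|x| ^+ 2 + `|p| ^+ 2 - `|b + c| ^+ 2 / 2
      - `|(b + c) ^+ 2 - 4 * (b * c)| / 2
    = (1 - (sqmod x + sqmod a + (sqmod b + sqmod c)) + sqmod p)%:C%C.
  have -> : (b + c) ^+ 2 - 4 * (b * c) = (b - c) ^+ 2 by ring.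
  rewrite -[LHS]addrA -opprD parallelogram !sqr_normE.
  by rewrite -!(rmorphB, rmorphD, rmorph1 (real_complex R)) /=; congr _%:C%C; ring.
split=> [[A /= A1 [xE aE pE sE]]|[[b b1 [c c1 [sE bcE]]] p1]].
- have [d1 D0] := (opnorm_lt1P A).1 A1.
  have bc : A 0 1 * A 1 0 = a * x - p by rewrite -xE -aE -pE det2; ring.
  split; last by rewrite -sE -bc offdiag ltcR -xE -aE -pE.
  + exists (A 0 1); first by rewrite /unit_disc /= norm_lt1 contraction_entry_lt1.
    exists (A 1 0); first by rewrite /unit_disc /= norm_lt1 contraction_entry_lt1.
    by rewrite bc sE.
  + by rewrite /unit_disc /= norm_lt1 -pE.
rewrite -sE -bcE offdiag ltcR => D0.
(* The two points of the disc behind the symmetrized bidisc become the off-diagonal entries. *)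
pose A : 'M[R[i]]_2 := \matrix_(i, j)
  if i == 0 then if j == 0 then x else b else if j == 0 then c else a.
have pE : \det A = p by rewrite det2 !mxE /= bcE; ring.
exists A; last by rewrite pE !mxE sE.
apply/opnorm_lt1P; rewrite pE /sqr_frobenius !mxE /=; split=> //.
by rewrite -norm_lt1.
Qed.
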